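(* In the setup of the context, let $s$ be a positive integer satisfying (C0) $\max_{i\in\{0,1\}}\bigl\{N(\mathbf n,\mathbf e_i)-\sum_{j\in\Lambda_i} n_j+1\bigr\}\le s$, and (C1) $n_{\Lambda_i[0]}\ge N(\mathbf n,\mathbf e_i)-s>0$ for each $i\in\{0,1\}$. Then $\dim\sigma_s(X_{\mathbf n,\mathbf d})\le F(\mathbf n,\mathbf e_0,\mathbf e_1)$, where $$F(\mathbf n,\mathbf e_0,\mathbf e_1)=s\,[D(\mathbf n)-E(\mathbf n)]+N(\mathbf n,\mathbf d)-1-\sum_{i\in\{0,1\}}N(\mathbf n,\mathbf e_{1-i})\,[N(\mathbf n,\mathbf e_i)-s]+\prod_{i\in\{0,1\}}[N(\mathbf n,\mathbf e_i)-s],$$ and $E(\mathbf n)=D(\mathbf n)-\sum_{i\in\{0,1\}}(N(\mathbf n,\mathbf e_i)-s)$.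
   Context: $K$ is an algebraically closed field of characteristic $0$. For $k$-tuples $\mathbf n=(n_0,\dots,n_{k-1})$, $\mathbf d=(d_0,\dots,d_{k-1})$ of non-negative integers set $N(\mathbf n,\mathbf d)=\prod_{i=0}^{k-1}\binom{n_i+d_i}{d_i}$ and $D(\mathbf n)=\sum_{i=0}^{k-1}n_i$. For positive $\mathbf n,\mathbf d$, let $V_i$ be a $K$-vector space of dimension $n_i+1$; the Segre–Veronese variety $X_{\mathbf n,\mathbf d}\subset\mathbb P\bigl(\bigotimes_{i}\mathrm{Sym}_{d_i}V_i\bigr)\cong\mathbb P^{N(\mathbf n,\mathbf d)-1}$ is the image of $\prod_i\mathbb P V_i$ under $([u_0],\dots,[u_{k-1}])\mapsto[u_0^{d_0}\otimes\cdots\otimes u_{k-1}^{d_{k-1}}]$; it has dimension $D(\mathbf n)$. The $s$-th secant variety $\sigma_s(X)$ is the Zariski closure of the union of all linear spans of $s$ linearly independent points of $X$. Standing setup: $k\ge2$, $\mathbf n$ positive, $\mathbf d=(1,\dots,1,d_{k-1})$ with $d_{k-1}\ge2$; $\mathbf e_0\in\mathbb Z_{\ge0}^k$ with $\mathbf e_0[j]\le\mathbf d[j]$ for all $j$ and $1\le\mathbf e_0[k-1]\le d_{k-1}-1$; $\mathbf e_1=\mathbf d-\mathbf e_0$. For $i\in\{0,1\}$, $\Lambda_i=\{j:\mathbf e_i[j]\ne0\}$, listed increasingly, $\Lambda_i[0]$ its smallest element; it is assumed that $\Lambda_i$ contains at least one index $\le k-2$. *)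

(* Defs.v *)
From HB Require Import structures.
From mathcomp Require Import all_boot all_order all_algebra.
Set Implicit Arguments. Unset Strict Implicit. Unset Printing Implicit Defensive.
Import Order.TTheory GRing.Theory Num.Theory.
Local Open Scope ring_scope.

Section AffGeom.
Variables (K : fieldType) (J : finType).

Definition pt := J -> K.

(* a polynomial in the variables (x_j)_{j in J}: a degree bound D and the
   coefficients of all monomials with exponents <= D in each variable *)
Definition mpoly := {D : nat & {ffun {ffun J -> 'I_D.+1} -> K}}.

Definition meval (p : mpoly) (x : pt) : K :=
  \sum_(e : {ffun J -> 'I_(projT1 p).+1})
     projT2 p e * \prod_(j : J) x j ^+ (nat_of_ord (e j)).

Definition zclosed (Z : pt -> Prop) : Prop :=
  exists F : mpoly -> Prop, forall x, Z x <-> (forall p, F p -> meval p x = 0).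

Definition zclosure (S : pt -> Prop) : pt -> Prop :=
  fun x => forall p, (forall y, S y -> meval p y = 0) -> meval p x = 0.

Definition subset_pt (A B : pt -> Prop) := forall x, A x -> B x.

Definition zirreducible (Z : pt -> Prop) : Prop :=
  [/\ zclosed Z, exists x, Z x &
      forall Z1 Z2, zclosed Z1 -> zclosed Z2 ->
        subset_pt Z (fun x => Z1 x \/ Z2 x) ->
        subset_pt Z Z1 \/ subset_pt Z Z2].

Definition zdim_le (Y : pt -> Prop) (b : int) : Prop :=
  forall (m : nat) (C : nat -> pt -> Prop),
    (forall i, (i <= m)%N -> zirreducible (C i) /\ subset_pt (C i) Y) ->
    (forall i, (i < m)%N ->
        subset_pt (C i) (C i.+1) /\ ~ subset_pt (C i.+1) (C i)) ->
    (m%:Z <= b).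

End AffGeom.

(* coordinates of V_0^{(x) d_0} (x) ... (x) V_{k-1}^{(x) d_{k-1}} *)
Definition SVidx (k : nat) (n d : nat -> nat) : finType :=
  {dffun forall i : 'I_k, {ffun 'I_(d i) -> 'I_(n i).+1}}.

(* u_0^{d_0} (x) ... (x) u_{k-1}^{d_{k-1}}, inside the symmetric tensors *)
Definition SVpoint (K : fieldType) (k : nat) (n d : nat -> nat)
  (u : forall i : 'I_k, 'I_(n i).+1 -> K) : pt K (SVidx k n d) :=
  fun j => \prod_(i < k) \prod_(l < d i) u i (j i l).

Definition SVcone (K : fieldType) (k : nat) (n d : nat -> nat)
  (x : pt K (SVidx k n d)) : Prop :=
  exists u, x = SVpoint (d := d) u.

Definition secant_union (K : fieldType) (k : nat) (n d : nat -> nat) (s : nat)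
  (x : pt K (SVidx k n d)) : Prop :=
  exists (p : 'I_s -> pt K (SVidx k n d)) (lam : 'I_s -> K),
    [/\ forall t, SVcone (p t),
        (forall c : 'I_s -> K, (forall j, \sum_(t < s) c t * p t j = 0) ->
            forall t, c t = 0) &
        forall j, x j = \sum_(t < s) lam t * p t j].

Definition secant_cone (K : fieldType) (k : nat) (n d : nat -> nat) (s : nat) :=
  zclosure (@secant_union K k n d s).

(* dim sigma_s(X) (projective) <= b  iff  dim of its affine cone <= b + 1 *)
Definition secant_dim_le (K : fieldType) (k : nat) (n d : nat -> nat) (s : nat)
  (b : int) : Prop :=
  zdim_le (@secant_cone K k n d s) (b + 1).

Definition Nnd (k : nat) (n e : nat -> nat) : nat :=
  \prod_(i < k) 'C(n i + e i, e i).

Definition Dn (k : nat) (n : nat -> nat) : nat := \sum_(i < k) n i.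

Definition sumLam (k : nat) (n e : nat -> nat) : nat :=
  \sum_(j < k | e j != 0%N) n j.

Definition lam0 (k : nat) (e : nat -> nat) : nat :=
  find (fun j => e j != 0%N) (iota 0 k).

(* Main.v *)
Require Import Defs.
From HB Require Import structures.
From Stdlib Require Import Classical.
From mathcomp Require Import all_boot all_order all_algebra.
From mathcomp Require Import zify ring.
Import Order.TTheory GRing.Theory Num.Theory.
Local Open Scope ring_scope.
Set Implicit Arguments. Unset Strict Implicit. Unset Printing Implicit Defensive.

(** Write [a_i = N(n,e_i) - s]; the bound [F] simplifies to [N(n,d) - 1 - a_0 a_1].
    Flattening a tensor along [e_0 + e_1 = d] gives a matrix whose rows and columns
    are indexed by the monomials of multidegree [e_0] and [e_1], whose entry at
    [(m, m')] is the coordinate of the product [m m'], and which has rank at most [s]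
    on the secant variety. By (C1) one can choose [a_0] row monomials and [a_1] column
    monomials, each involving only one variable of the last factor, such that their
    [a_0 a_1] products factor uniquely. These coordinates therefore do not occur in
    the remaining rows and columns, and as the complementary [s * s] minor is generically
    invertible, they are rational functions of the other [N(n,d) - a_0 a_1] coordinates.
    A chain of [m + 1] irreducible closed sets yields [m] algebraically independent
    functions, so counting monomials of bounded degree gives [m <= N(n,d) - a_0 a_1]. *)

(** * Functions polynomial in a finite family of functions *)

Section PolyFun.
Variables (K : fieldType) (P : Type) (B : finType) (y : B -> P -> K).

(** Bounding each exponent separately makes these functions the span of [(L+1)^#|B|] monomials, the
    count used in [polyfun_dependent]. *)
Definition polyfun_le (L : nat) (f : P -> K) : Prop :=
  exists c : {ffun {ffun B -> 'I_L.+1} -> K}, forall x,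
    f x = \sum_(a : {ffun B -> 'I_L.+1})
      c a * \prod_(b : B) y b x ^+ (nat_of_ord (a b)).

Definition polyfun (f : P -> K) : Prop := exists L, polyfun_le L f.

Lemma eq_polyfun_le L f g : f =1 g -> polyfun_le L f -> polyfun_le L g.
Proof. by move=> fg [c hc]; exists c => x; rewrite -fg. Qed.

Lemma eq_polyfun f g : f =1 g -> polyfun f -> polyfun g.
Proof. by move=> fg [L hL]; exists L; apply: eq_polyfun_le hL. Qed.

Lemma polyfun_le_monom L (a : B -> nat) : (forall b, (a b <= L)%N) ->
  polyfun_le L (fun x => \prod_b y b x ^+ a b).
Proof.
move=> aL; pose a' : {ffun B -> 'I_L.+1} := [ffun b => inord (a b)].
exists [ffun e => (e == a')%:R] => x.
rewrite (bigD1 a') //= ffunE eqxx mul1r [X in _ + X]big1 ?addr0 => [|e /negPf ne].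
  by apply: eq_bigr => b _; rewrite ffunE inordK ?ltnS.
by rewrite ffunE ne mul0r.
Qed.

Lemma polyfun_leZ L k f : polyfun_le L f -> polyfun_le L (fun x => k * f x).
Proof.
move=> [c hc]; exists [ffun a => k * c a] => x.
by rewrite hc mulr_sumr; apply: eq_bigr => a _; rewrite ffunE mulrA.
Qed.

Lemma polyfun_leD L f g : polyfun_le L f -> polyfun_le L g ->
  polyfun_le L (fun x => f x + g x).
Proof.
move=> [c hc] [c' hc']; exists [ffun a => c a + c' a] => x.
by rewrite hc hc' -big_split; apply: eq_bigr => a _; rewrite ffunE mulrDl.
Qed.

Lemma polyfun_le_cst L k : polyfun_le L (fun=> k).
Proof.
have := polyfun_leZ k (@polyfun_le_monom L (fun=> 0%N) (fun=> leq0n _)).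
by apply: eq_polyfun_le => x; rewrite big1 ?mulr1.
Qed.

Lemma polyfun_le_sum L (I : Type) (r : seq I) (F : I -> P -> K) :
  (forall i, polyfun_le L (F i)) -> polyfun_le L (fun x => \sum_(i <- r) F i x).
Proof.
move=> FL; elim: r => [|i r IH].
  by apply: eq_polyfun_le (polyfun_le_cst L 0) => x; rewrite big_nil.
by apply: eq_polyfun_le (polyfun_leD (FL i) IH) => x; rewrite big_cons.
Qed.

Lemma polyfun_leW L M f : (L <= M)%N -> polyfun_le L f -> polyfun_le M f.
Proof.
move=> LM [c hc].
apply: (@eq_polyfun_le _ (fun x => \sum_a c a * \prod_b y b x ^+ a b)) => [x|].
  by rewrite hc.
apply: polyfun_le_sum => a; apply/polyfun_leZ/polyfun_le_monom => b.
by apply: leq_trans LM; rewrite -ltnS.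
Qed.

Lemma polyfun_leM L M f g : polyfun_le L f -> polyfun_le M g ->
  polyfun_le (L + M) (fun x => f x * g x).
Proof.
move=> [c hc] [c' hc'].
apply: (@eq_polyfun_le _ (fun x => \sum_a \sum_a'
    c a * (c' a' * \prod_b y b x ^+ (a b + a' b)))) => [x|].
  rewrite hc hc' mulr_suml; apply: eq_bigr => a _.
  rewrite mulr_sumr; apply: eq_bigr => a' _.
  under eq_bigr do rewrite exprD.
  by rewrite big_split /=; ring.
do 2![apply: polyfun_le_sum => ?]; do 2!apply: polyfun_leZ.
by apply: polyfun_le_monom => b; rewrite leq_add // -ltnS.
Qed.

Lemma polyfun_leX L n f : polyfun_le L f ->
  polyfun_le (n * L) (fun x => f x ^+ n).
Proof.
move=> fL; elim: n => [|n IH]; first exact: polyfun_le_cst.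
by rewrite mulSn; apply: eq_polyfun_le (polyfun_leM fL IH) => x; rewrite exprS.
Qed.

Lemma polyfun_le_prod L (I : Type) (r : seq I) (F : I -> P -> K) :
  (forall i, polyfun_le L (F i)) ->
  polyfun_le (size r * L) (fun x => \prod_(i <- r) F i x).
Proof.
move=> FL; elim: r => [|i r IH].
  by apply: eq_polyfun_le (polyfun_le_cst 0 1) => x; rewrite big_nil.
rewrite /= mulSn.
by apply: eq_polyfun_le (polyfun_leM (FL i) IH) => x; rewrite big_cons.
Qed.

Lemma polyfun_var b : polyfun (y b).
Proof.
exists 1%N.
apply: eq_polyfun_le (@polyfun_le_monom 1 (fun b' => (b' == b) : nat) _) => [x|b'].
  rewrite (bigD1 b) //= eqxx expr1 big1 ?mulr1 // => b' /negPf->.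
  by rewrite expr0.
by case: (b' == b).
Qed.

Lemma polyfun_cst k : polyfun (fun=> k).
Proof. by exists 0%N; apply: polyfun_le_cst. Qed.

Lemma polyfunD f g : polyfun f -> polyfun g -> polyfun (fun x => f x + g x).
Proof.
move=> [L fL] [M gM]; exists (maxn L M).
by apply: polyfun_leD; [apply: polyfun_leW fL | apply: polyfun_leW gM];
  rewrite ?leq_maxl ?leq_maxr.
Qed.

Lemma polyfunM f g : polyfun f -> polyfun g -> polyfun (fun x => f x * g x).
Proof. by move=> [L fL] [M gM]; exists (L + M)%N; apply: polyfun_leM. Qed.

Lemma polyfunX n f : polyfun f -> polyfun (fun x => f x ^+ n).
Proof. by move=> [L fL]; exists (n * L)%N; apply: polyfun_leX. Qed.

Lemma polyfun_sum (I : Type) (r : seq I) (p : pred I) (F : I -> P -> K) :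
  (forall i, p i -> polyfun (F i)) ->
  polyfun (fun x => \sum_(i <- r | p i) F i x).
Proof.
move=> FL; elim: r => [|i r IH].
  by apply: eq_polyfun (polyfun_cst 0) => x; rewrite big_nil.
case pi: (p i); last by apply: eq_polyfun IH => x; rewrite big_cons pi.
by apply: eq_polyfun (polyfunD (FL i pi) IH) => x; rewrite big_cons pi.
Qed.

Lemma polyfun_prod (I : Type) (r : seq I) (p : pred I) (F : I -> P -> K) :
  (forall i, p i -> polyfun (F i)) ->
  polyfun (fun x => \prod_(i <- r | p i) F i x).
Proof.
move=> FL; elim: r => [|i r IH].
  by apply: eq_polyfun (polyfun_cst 1) => x; rewrite big_nil.
case pi: (p i); last by apply: eq_polyfun IH => x; rewrite big_cons pi.
by apply: eq_polyfun (polyfunM (FL i pi) IH) => x; rewrite big_cons pi.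
Qed.

Lemma polyfun_det n (A : P -> 'M[K]_n) :
  (forall i j, polyfun (fun x => A x i j)) -> polyfun (fun x => \det (A x)).
Proof.
move=> hA; rewrite /determinant; apply: polyfun_sum => s _.
by apply: polyfunM; [apply: polyfun_cst | apply: polyfun_prod].
Qed.

Lemma polyfun_adj n (A : P -> 'M[K]_n) :
  (forall i j, polyfun (fun x => A x i j)) ->
  forall i j, polyfun (fun x => (\adj (A x)) i j).
Proof.
move=> hA i j; apply: (@eq_polyfun (fun x => cofactor (A x) j i)) => [x|].
  by rewrite mxE.
apply: polyfunM; first exact: polyfun_cst.
apply: polyfun_det => i' j'.
by apply: (eq_polyfun _ (hA (lift j i') (lift i j'))) => x; rewrite !mxE.
Qed.

(* There are [(q+1)^m] products on the left, all lying in a space of dimension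
   [O(q^#|B|)]. *)
Lemma polyfun_dependent m (D : P -> K) (h : 'I_m -> P -> K) :
  (#|B| < m)%N -> polyfun D -> (forall i, polyfun (h i)) ->
  exists q, exists2 c : {ffun {ffun 'I_m -> 'I_q.+1} -> K},
    exists a, c a != 0 &
    forall x, \sum_a c a * \prod_i (h i x ^+ a i * D x ^+ (q - a i)) = 0.
Proof.
move=> Bm [L0 DL0] /fin_all_exists [L hL].
pose l := (L0 + \sum_i L i)%N.
have Dl : polyfun_le l D by apply: polyfun_leW DL0; rewrite leq_addr.
have hl i : polyfun_le l (h i).
  by apply: polyfun_leW (hL i); rewrite /l (bigD1 i) //= addnCA leq_addr.
(* This choice forces [(M+1)^#|B| < (q+1)^m]: since [M+1 <= (m*l+1)*(q+1)], the left side is at most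
   [q*(q+1)^#|B|], and [#|B| < m]. *)
pose q := ((m * l).+1 ^ #|B|)%N.
pose M := (m * (q * l))%N.
have term (a : {ffun 'I_m -> 'I_q.+1}) :
    polyfun_le M (fun x => \prod_i (h i x ^+ a i * D x ^+ (q - a i))).
  rewrite /M -{1}(size_enum_ord m).
  apply: (@eq_polyfun_le _ (fun x => \prod_(i <- enum 'I_m)
     (h i x ^+ a i * D x ^+ (q - a i)))) => [x|]; first by rewrite big_enum.
  apply: polyfun_le_prod => i.
  have aq : (a i <= q)%N by rewrite -ltnS.
  rewrite -{1}(subnKC aq) mulnDl.
  by apply: polyfun_leM; apply: polyfun_leX.
have [C hC] := fin_all_exists term.
pose A := \matrix_(i < #|{ffun 'I_m -> 'I_q.+1}|, j < #|{ffun B -> 'I_M.+1}|)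
   C (enum_val i) (enum_val j).
have : kermx A != 0.
  rewrite kermx_eq0 -row_leq_rank -ltnNge; apply: leq_ltn_trans (rank_leq_col _) _.
  rewrite !card_ffun !card_ord.
  have le1 : (M.+1 ^ #|B| <= ((m * l).+1 * q.+1) ^ #|B|)%N.
    have [->//|B0] := posnP #|B|.
    by rewrite leq_exp2r // /M; nia.
  apply: leq_ltn_trans le1 _; rewrite expnMn -/q.
  apply: (@leq_trans (q.+1 ^ #|B|.+1)%N); last by rewrite leq_exp2l // ltnS expn_gt0.
  by rewrite expnS ltn_pmul2r ?expn_gt0.
case/rowV0Pn => v /sub_kermxP vA /rV0Pn [i0 vi0].
exists q, [ffun a => v 0 (enum_rank a)].
  by exists (enum_val i0); rewrite ffunE enum_valK.
move=> x.
under eq_bigr => a _ do rewrite hC mulr_sumr.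
rewrite exchange_big /= big1 // => b _.
under eq_bigr => a _ do rewrite mulrA ffunE.
rewrite -mulr_suml (reindex_onto enum_val enum_rank) => [|a _]; last exact: enum_rankK.
under eq_bigl => i do rewrite enum_valK eqxx.
move/rowP/(_ (enum_rank b)): vA; rewrite !mxE => vA0.
rewrite [X in X * _](_ : _ = 0) ?mul0r // -[RHS]vA0.
by apply: eq_bigr => i _; rewrite enum_valK !mxE enum_rankK.
Qed.

End PolyFun.

(** * Algebraically independent functions from chains of irreducible closed sets *)

Section Chains.
Variables (K : fieldType) (J : finType).

Definition pt_coord (j : J) (x : pt K J) : K := x j.

Lemma polyfun_meval (p : Defs.mpoly K J) : polyfun pt_coord (meval p).
Proof. by exists (projT1 p), (projT2 p). Qed.

Lemma polyfun_coordP f : polyfun pt_coord f ->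
  exists p : Defs.mpoly K J, forall x, meval p x = f x.
Proof. by move=> [L [c hc]]; exists (existT _ L c) => x; rewrite hc. Qed.

Lemma polyfun_eq1 (f : pt K J -> K) x z : polyfun pt_coord f -> x =1 z -> f x = f z.
Proof.
move=> [L [c hc]] xz; rewrite !hc; apply: eq_bigr => a _; congr (_ * _).
by apply: eq_bigr => i _; rewrite /pt_coord xz.
Qed.

(** The zero sets of [f] and [g] are closed and cover [Z]; irreducibility puts [Z] inside one of
    them, and [x0] excludes the first. *)
Lemma zirreducible_cancel (Z : pt K J -> Prop) f g x0 :
  zirreducible Z -> polyfun pt_coord f -> polyfun pt_coord g ->
  Z x0 -> f x0 != 0 -> (forall x, Z x -> f x * g x = 0) ->
  forall x, Z x -> g x = 0.
Proof.
move=> [_ _ irr] /polyfun_coordP [p hp] /polyfun_coordP [r hr] Zx0 fx0 fg x Zx.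
pose V (t : Defs.mpoly K J) x := meval t x = 0.
have Vcl t : zclosed (V t).
  by exists (eq t) => z; split=> [? _ <-|h] //; apply: h.
case: (irr _ _ (Vcl p) (Vcl r)) => [z Zz|/(_ _ Zx0)|/(_ _ Zx)].
- have /eqP := fg z Zz; rewrite -hp -hr mulf_eq0 => /orP[]/eqP; by [left|right].
- by rewrite /V hp => /eqP; rewrite (negPf fx0).
- by rewrite /V hr.
Qed.

(* [f i] is chosen to vanish on [C i] but not on [C i.+1]. A relation between
   the [f i] on [C i.+1] is divided by the largest possible power of [f i] and
   restricted to [C i]; this leaves the terms of least exponent in [f i]. *)
Lemma chain_independent m (C : nat -> pt K J -> Prop) :
  (forall i, (i <= m)%N -> zirreducible (C i)) ->
  (forall i, (i < m)%N ->
     subset_pt (C i) (C i.+1) /\ ~ subset_pt (C i.+1) (C i)) ->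
  exists2 f : 'I_m -> pt K J -> K, forall i, polyfun pt_coord (f i) &
    forall q (c : {ffun {ffun 'I_m -> 'I_q.+1} -> K}),
    (forall x, C m x -> \sum_a c a * \prod_i f i x ^+ a i = 0) ->
    forall a, c a = 0.
Proof.
move=> irrC chC.
have sep (i : 'I_m) : exists g, [/\ polyfun pt_coord g,
    forall x, C i x -> g x = 0 & exists2 x, C i.+1 x & g x != 0].
  have [_ nsub] := chC i (ltn_ord i).
  have [[F hF] _ _] := irrC i (ltnW (ltn_ord i)).
  have [x /(imply_to_and (C i.+1 x) (C i x)) [Cx nCx]] := not_all_ex_not _ _ nsub.
  have [p /(imply_to_and (F p)) [Fp px]] : exists p, ~ (F p -> meval p x = 0).
    by apply: not_all_ex_not => h; apply/nCx/hF.
  exists (meval p); split; first exact: polyfun_meval.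
    by move=> z /hF; apply.
  by exists x => //; apply/eqP.
have [f hf] := fin_all_exists sep.
exists f => [i|q c hc a]; first by have [] := hf i.
apply/eqP; apply: contraT => ca; exfalso.
(* Descent from [C m] to [C 0]: [S] holds the exponent vectors that survive the elimination of the
   last [j] functions, and they agree in those [j] places. *)
have desc j : (j <= m)%N -> exists S : {set {ffun 'I_m -> 'I_q.+1}},
    [/\ S != set0, forall b, b \in S -> c b != 0,
      forall b b', b \in S -> b' \in S ->
        forall l : 'I_m, (m - j <= l)%N -> b l = b' l &
      forall x, C (m - j)%N x ->
        \sum_(b in S) c b * \prod_(l < m | (l < m - j)%N) f l x ^+ b l = 0].
  elim: j => [_|j IHj jm].
    exists [set b | c b != 0]; rewrite subn0; split.
    - by apply/set0Pn; exists a; rewrite inE.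
    - by move=> b; rewrite inE.
    - by move=> b b' _ _ l; rewrite leqNgt ltn_ord.
    move=> x Cx; rewrite -[RHS](hc x Cx) [LHS]big_mkcond /=; apply: eq_bigr => b _.
    rewrite inE; case: eqP => [->|_] /=; first by rewrite mul0r.
    by congr (_ * _); apply: eq_bigl => l; rewrite ltn_ord.
  have [S [/set0Pn [b0 b0S] Sc Seq Ssum]] := IHj (ltnW jm).
  have im : (m - j.+1 < m)%N by lia.
  pose o := Ordinal im.
  have eo : (m - j)%N = o.+1 by rewrite /=; lia.
  rewrite eo in Ssum Seq.
  have [pf fC [x0 Cx0 fx0]] := hf o.
  have [b1 b1S bmin] := arg_minnP (fun b : {ffun 'I_m -> 'I_q.+1} => b o : nat) b0S.
  pose g x := \sum_(b in S) c b *
     (f o x ^+ (b o - b1 o) * \prod_(l < m | (l < o)%N) f l x ^+ b l).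
  have pg : polyfun pt_coord g.
    apply: polyfun_sum => b _; apply: polyfunM; first exact: polyfun_cst.
    apply: polyfunM; first exact: polyfunX.
    by apply: polyfun_prod => l _; apply: polyfunX; have [] := hf l.
  have pfX : polyfun pt_coord (fun x => f o x ^+ b1 o) by apply: polyfunX.
  have om : (o.+1 <= m)%N by [].
  have g0 : forall x, C o.+1 x -> g x = 0.
    apply: (zirreducible_cancel (irrC _ om) pfX pg Cx0); first by rewrite expf_neq0.
    move=> x Cx; rewrite -[RHS](Ssum x Cx) mulr_sumr; apply: eq_bigr => b bS.
    rewrite mulrCA; congr (_ * _).
    rewrite [in RHS](bigD1 o) //= mulrA -exprD subnKC; last exact: bmin.
    congr (_ * _); apply: eq_bigl => l.
    by rewrite -val_eqE /=; lia.
  exists [set b in S | b o == b1 o]; split.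
  - by apply/set0Pn; exists b1; rewrite inE eqxx andbT.
  - by move=> b; rewrite inE => /andP[/Sc].
  - move=> b b'; rewrite !inE => /andP[bS /eqP bo] /andP[b'S /eqP b'o] l.
    rewrite leq_eqVlt => /orP[/eqP ol|]; last exact: Seq.
    by have <- : o = l by [apply: val_inj]; rewrite bo b'o.
  move=> x Cx; rewrite -[(m - j.+1)%N]/(nat_of_ord o).
  have Cx' : C o.+1 x by case: (chC o (ltn_ord o)) => sub _; apply: sub.
  rewrite -[RHS](g0 x Cx') /g.
  rewrite [RHS](bigID (fun b : {ffun 'I_m -> 'I_q.+1} => b o == b1 o)) /=.
  rewrite [X in _ + X]big1 ?addr0.
    apply: eq_big => [b|b]; first by rewrite inE.
    by rewrite inE => /andP[_ /eqP->]; rewrite subnn expr0 mul1r.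
  move=> b /andP[bS nb]; rewrite fC // expr0n.
  have -> : (b o - b1 o == 0)%N = false.
    by move: (bmin b bS) nb; rewrite -val_eqE /=; lia.
  by rewrite mul0r mulr0.
(* After [m] steps all elements of [S] coincide and the products are empty, so the one remaining
   coefficient is zero, against [Sc]. *)
have [S []] := desc m (leqnn m); rewrite subnn => /set0Pn [b bS] Sc Seq Ssum.
have [_ [x Cx] _] := irrC 0%N (leq0n m).
move: (Ssum x Cx); rewrite (bigD1 b) //= [X in _ * X]big1 ?mulr1 //.
rewrite [X in _ + X]big1 ?addr0 => [cb|b' /andP[b'S /eqP[]]].
  by have := Sc b bS; rewrite cb eqxx.
by apply/ffunP => l; apply: Seq.
Qed.

End Chains.

(** * Integers and polynomials in characteristic zero *)

Lemma natr_inj_pchar0 (K : fieldType) : [pchar K] =i pred0 ->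
  injective (fun n : nat => n%:R : K).
Proof.
move=> /pcharf0P charK0.
have le a b : (a <= b)%N -> a%:R = b%:R :> K -> a = b.
  move=> ab eab; have /eqP : (b - a)%:R = 0 :> K by rewrite natrB // eab subrr.
  by rewrite charK0; lia.
move=> a b; have [ab|/ltnW ba] := leqP a b; first exact: le.
by move/esym/le => ->.
Qed.

Lemma poly_eq0_pchar0 (K : fieldType) (p : {poly K}) : [pchar K] =i pred0 ->
  (forall t, p.[t] = 0) -> p = 0.
Proof.
move=> charK0 hp; apply/eqP; apply: contraT => p0.
have : (size [seq i%:R : K | i <- iota 0 (size p)] < size p)%N.
  apply: max_poly_roots => //; first by apply/allP => t _; apply/rootP.
  by rewrite map_inj_uniq ?iota_uniq //; apply: natr_inj_pchar0.
by rewrite size_map size_iota ltnn.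
Qed.

(** * Dimension of the closure of a parametrized set *)

Section Param.
Variables (K : fieldType) (Q : finType).
Hypothesis charK0 : [pchar K] =i pred0.
Notation coordQ := (@pt_coord K Q).

Lemma polyfun_line (f : pt K Q -> K) (x z : pt K Q) : polyfun coordQ f ->
  exists p : {poly K}, forall t, p.[t] = f (fun i => x i + t * (z i - x i)).
Proof.
move=> [L [c hc]].
exists (\sum_a (c a)%:P * \prod_i ((x i)%:P + 'X * (z i - x i)%:P) ^+ a i) => t.
rewrite hc horner_sum; apply: eq_bigr => a _; rewrite hornerM hornerC horner_prod.
by congr (_ * _); apply: eq_bigr => i _; rewrite !hornerE.
Qed.

(** On the line through [x0] and [z] both functions become polynomials in one variable with product
    zero. The first takes the value [D x0] at [0], so it is nonzero and the second vanishes; its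
    value at [1] is [f z]. *)
Lemma polyfun_cancel (D f : pt K Q -> K) x0 :
  polyfun coordQ D -> polyfun coordQ f -> D x0 != 0 ->
  (forall x, D x * f x = 0) -> forall z, f z = 0.
Proof.
move=> pD pf Dx0 Df z.
have [p hp] := polyfun_line x0 z pD; have [r hr] := polyfun_line x0 z pf.
have /eqP : p * r = 0.
  by apply: poly_eq0_pchar0 => // t; rewrite hornerM hp hr Df.
rewrite mulf_eq0 => /orP[]/eqP pr0.
  case/eqP: Dx0.
  have <- : D (fun i => x0 i + 0 * (z i - x0 i)) = D x0.
    by apply: polyfun_eq1 => // i; rewrite mul0r addr0.
  by rewrite -hp pr0 horner0.
have <- : f (fun i => x0 i + 1 * (z i - x0 i)) = f z.
  by apply: polyfun_eq1 => // i; rewrite mul1r addrC subrK.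
by rewrite -hr pr0 horner0.
Qed.

(* The hypotheses say that the coordinates [phi j] lie in the field generated by
   the [#|B|] functions [y b], which bounds the transcendence degree. *)
Lemma zdim_le_param (J B : finType) (phi : J -> pt K Q -> K)
    (y : B -> pt K Q -> K) (D : pt K Q -> K) x0 (Y : pt K J -> Prop) :
  (forall j, polyfun coordQ (phi j)) -> polyfun coordQ D -> D x0 != 0 ->
  polyfun y D -> (forall j, polyfun y (fun x => D x * phi j x)) ->
  subset_pt Y (zclosure (fun z => exists x, forall j, z j = phi j x)) ->
  zdim_le Y #|B|%:Z.
Proof.
move=> pphi pD Dx0 pyD pyphi Ysub m C irrC chC.
have [f pf find] := chain_independent (fun i im => (irrC i im).1) chC.
rewrite lez_nat leqNgt; apply/negP => Bm.
have pull g : polyfun (@pt_coord K J) g -> polyfun coordQ (fun x => g (phi^~ x)).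
  move=> [L [c hc]].
  apply: (@eq_polyfun _ _ _ _ (fun x => \sum_(a : {ffun J -> 'I_L.+1})
     c a * \prod_j phi j x ^+ a j)) => [x|]; first by rewrite hc.
  apply: polyfun_sum => a _; apply: polyfunM; first exact: polyfun_cst.
  by apply: polyfun_prod => j _; apply: polyfunX.
have clear_den g : polyfun (@pt_coord K J) g ->
    exists d, polyfun y (fun x => D x ^+ d * g (phi^~ x)).
  (* One factor [D x ^+ L] per coordinate suffices to turn each power of [phi j x] up to [L] into a
     power of [D x * phi j x]. *)
  move=> [L [c hc]]; exists (\sum_(j : J) L)%N.
  apply: (@eq_polyfun _ _ _ _ (fun x => \sum_(a : {ffun J -> 'I_L.+1})
     c a * \prod_j ((D x * phi j x) ^+ a j * D x ^+ (L - a j)))) => [x|].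
    rewrite hc mulr_sumr; apply: eq_bigr => a _; rewrite mulrCA; congr (_ * _).
    rewrite -prodrXr -big_split; apply: eq_bigr => j _ /=.
    rewrite exprMn mulrAC -exprD subnKC //.
    by rewrite -ltnS.
  apply: polyfun_sum => a _; apply: polyfunM; first exact: polyfun_cst.
  by apply: polyfun_prod => j _; apply: polyfunM; apply: polyfunX.
have [d hd] := fin_all_exists (fun i => clear_den (f i) (pf i)).
pose e := (\sum_i d i)%N.
have pyD' : polyfun y (fun x => D x ^+ e) by apply: polyfunX.
have hd' i : polyfun y (fun x => D x ^+ e * f i (phi^~ x)).
  have de : (d i <= e)%N by rewrite /e (bigD1 i) //= leq_addr.
  apply: eq_polyfun (polyfunM (polyfunX (e - d i) pyD) (hd i)) => x.
  by rewrite mulrA -exprD subnK.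
have [q [c [a ca] rel]] := polyfun_dependent Bm pyD' hd'.
case/eqP: ca; apply: find => z Cz.
pose g w := \sum_a c a * \prod_i f i w ^+ a i.
have pg : polyfun (@pt_coord K J) g.
  apply: polyfun_sum => b _; apply: polyfunM; first exact: polyfun_cst.
  by apply: polyfun_prod => j _; apply: polyfunX.
have gphi0 : forall x, g (phi^~ x) = 0.
  (* Each factor in [rel] is [D x ^+ (e * q)] times a power of [f i], so the relation is [g]
     multiplied by this power of [D]. *)
  apply: (@polyfun_cancel (fun x => D x ^+ (\sum_(i < m) e * q)%N) _ x0).
  - exact: polyfunX.
  - exact: pull.
  - by rewrite expf_neq0.
  move=> x; rewrite -[RHS](rel x) mulr_sumr; apply: eq_bigr => b _.
  rewrite mulrCA; congr (_ * _); rewrite -prodrXr -big_split; apply: eq_bigr => i _.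
  by rewrite /= exprMn mulrAC -exprD subnKC -?exprM // -ltnS.
have [p hp] := polyfun_coordP pg.
have Yz : Y z by apply: (irrC m (leqnn m)).2.
(* [g] vanishes on the image of [phi], hence on its closure, which contains [Y] and so [C m]. *)
rewrite -/(g z) -hp; apply: (Ysub z Yz) => w [x hw].
by rewrite hp -(gphi0 x); apply: polyfun_eq1.
Qed.

End Param.

(** * Distinct primes and Vandermonde determinants *)

Lemma logn_prod (I : Type) (r : seq I) p (F : I -> nat) :
  (forall i, 0 < F i)%N ->
  logn p (\prod_(i <- r) F i) = (\sum_(i <- r) logn p (F i))%N.
Proof.
move=> F0; elim: r => [|i r IH]; first by rewrite !big_nil logn1.
by rewrite !big_cons lognM ?IH // prodn_gt0.
Qed.

(** Serves to encode exponent vectors as integers, injectively by unique factorization. *)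
Lemma injective_primes (V : finType) :
  exists2 p : V -> nat, injective p & forall v, prime (p v).
Proof.
pose q i := iter i (fun m => s2val (prime_above m)) 2%N.
have qS i : (q i < q i.+1)%N by rewrite /= ; case: prime_above.
have qp i : prime (q i) by case: i => //= i; case: prime_above.
have q_inj : injective q.
  by apply: incn_inj; apply: leq_mono; apply: homo_ltn qS; apply: ltn_trans.
exists (fun v => q (enum_rank v)) => // v w /q_inj/val_inj.
exact: enum_rank_inj.
Qed.

Lemma det_Vandermonde_neq0 (K : fieldType) s (a : 'rV[K]_s) :
  injective (a 0) -> \det (Vandermonde s a) != 0.
Proof.
move=> a_inj; rewrite det_Vandermonde; apply/prodf_neq0 => i _.
apply/prodf_neq0 => j ij; rewrite subr_eq0.
by apply: contraTneq ij => /a_inj ->; rewrite ltnn.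
Qed.

(** * Monomials of a given multidegree *)

Section Monomials.
Variables (k : nat) (n : nat -> nat).

Definition var : finType := {i : 'I_k & 'I_(n i).+1}.
Definition mkvar (i : 'I_k) (c : 'I_(n i).+1) : var :=
  Tagged (fun i : 'I_k => 'I_(n i).+1) c.

(* The monomials of multidegree [e], stored as exponent vectors. *)
Definition monom_part (e : nat -> nat) (i : 'I_k) : finType :=
  {t : (n i).+1.-tuple 'I_(e i).+1 | (\sum_(x <- t) x == e i)%N}.
Definition monom (e : nat -> nat) : finType :=
  {dffun forall i : 'I_k, monom_part e i}.

Definition expo e (m : monom e) (v : var) : nat :=
  tnth (val (m (tag v))) (tagged v).

Lemma card_monom (e : nat -> nat) : #|monom e| = Nnd k n e.
Proof.
rewrite card_dep_ffun foldrE big_map big_enum; apply: eq_bigr => i _.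
rewrite card_sig -bin_sub ?leq_addl // addnK -card_ord_partitions -cardsE.
by apply: eq_card => t; rewrite !inE.
Qed.

Lemma expo_inj (e : nat -> nat) (m m' : monom e) : expo m =1 expo m' -> m = m'.
Proof.
move=> mm; apply/ffunP => i; apply/val_inj/eq_from_tnth => c.
by apply: val_inj; apply: (mm (mkvar c)).
Qed.

Lemma expo_sum (e : nat -> nat) (m : monom e) (i : 'I_k) :
  (\sum_c expo m (@mkvar i c) = e i)%N.
Proof.
rewrite -[RHS](eqP (valP (m i))) big_tuple.
by apply: eq_bigr.
Qed.

Lemma expo_surj (e : nat -> nat) (x : var -> nat) :
  (forall i : 'I_k, \sum_c x (@mkvar i c) = e i)%N ->
  exists m : monom e, expo m =1 x.
Proof.
move=> xe.
have xle i c : (x (@mkvar i c) < (e i).+1)%N.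
  by rewrite ltnS -xe (bigD1 c) //= leq_addr.
pose t (i : 'I_k) : (n i).+1.-tuple 'I_(e i).+1 :=
  [tuple inord (x (@mkvar i c)) | c < (n i).+1].
have tP (i : 'I_k) : (\sum_(z <- t i) z == e i)%N.
  rewrite big_tuple -[X in _ == X]xe; apply/eqP/eq_bigr => c _.
  by rewrite tnth_mktuple inordK.
exists [ffun i => exist _ (t i) (tP i)] => -[i c].
by rewrite /expo ffunE /= tnth_mktuple inordK //; apply: xle.
Qed.

Lemma monom_mul (e0 e1 d : nat -> nat) : (forall i : 'I_k, e0 i + e1 i = d i)%N ->
  exists mul : monom e0 * monom e1 -> monom d,
    forall p v, expo (mul p) v = (expo p.1 v + expo p.2 v)%N.
Proof.
move=> ed.
have ex (p : monom e0 * monom e1) :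
    exists m : monom d, forall v, expo m v = (expo p.1 v + expo p.2 v)%N.
  by apply: expo_surj => i; rewrite big_split /= !expo_sum.
by have [mul hmul] := fin_all_exists ex; exists mul.
Qed.

(** Exponents are compared factor by factor. If one multidegree vanishes at [i], all exponents there
    belong to the other monomial. Otherwise [m] and [r], hence also [m'] and [r'], use only variable
    [0], whose exponent is the degree. *)
Lemma monom_factor_unique (e0 e1 : nat -> nat) (m m' : monom e0) (r r' : monom e1) :
  (forall i : 'I_k, [\/ e0 i = 0, e1 i = 0 |
     forall c : 'I_(n i).+1, c != ord0 ->
       expo m (mkvar c) + expo r (mkvar c) = 0])%N ->
  (forall v, expo m v + expo r v = expo m' v + expo r' v)%N ->
  m = m' /\ r = r'.
Proof.
move=> sep eqv.
have zero (e : nat -> nat) (l : monom e) (i : 'I_k) c :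
    e i = 0%N -> expo l (@mkvar i c) = 0%N.
  by move=> ei; have := expo_sum l i; rewrite (bigD1 c) //= ei; lia.
have at0 (e : nat -> nat) (l : monom e) (i : 'I_k) :
    (forall c : 'I_(n i).+1, c != ord0 -> expo l (mkvar c) = 0)%N ->
    expo l (@mkvar i ord0) = e i.
  by move=> l0; rewrite -(expo_sum l i) (bigD1 ord0) //= big1 ?addn0.
suff mm' : expo m =1 expo m'.
  by split; apply: expo_inj => // v; have := eqv v; rewrite mm'; lia.
move=> [i c]; rewrite -/(mkvar c).
case: (sep i) => [e0i|e1i|supp].
- by rewrite !zero.
- by have := eqv (mkvar c); rewrite (zero _ r) // (zero _ r') // !addn0.
have m0 c' : c' != ord0 -> expo m (@mkvar i c') = 0%N by move/supp; lia.
have m'0 c' : c' != ord0 -> expo m' (@mkvar i c') = 0%N.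
  by move/supp; have := eqv (mkvar c'); lia.
by have [->|nc] := eqVneq c ord0; [rewrite !at0 | rewrite m0 ?m'0].
Qed.

(** The witnesses are variable [b] of factor [j] to the power [e j], for [b < a], times variable [0]
    of every other factor to its full degree. *)
Lemma monom_family (e : nat -> nat) (j : 'I_k) (a : nat) :
  (0 < e j)%N -> (a <= n j)%N ->
  exists2 R : {set monom e}, #|R| = a &
    forall m, m \in R -> forall (i : 'I_k) (c : 'I_(n i).+1),
      i != j -> c != ord0 -> expo m (mkvar c) = 0%N.
Proof.
move=> ej an.
pose x (b : 'I_a) (v : var) : nat :=
  (e (tag v) * (tagged v == (if tag v == j then b : nat else 0) :> nat))%N.
have mex b : exists m : monom e, expo m =1 x b.
  apply: expo_surj => i.
  have lt : ((if i == j then b : nat else 0) < (n i).+1)%N.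
    by case: eqP => [->|//]; rewrite ltnS ltnW // (leq_trans _ an).
  rewrite (bigD1 (Ordinal lt)) //= big1 ?addn0 => [|c].
    by rewrite /x /= eqxx muln1.
  by rewrite -val_eqE /x /= => /negPf->; rewrite muln0.
have [m hm] := fin_all_exists mex.
exists [set m b | b in 'I_a] => [|_ /imsetP [b _ ->] i c ij c0].
  rewrite card_imset ?card_ord // => b b' mbb'.
  have lt : (b < (n j).+1)%N by rewrite ltnS ltnW // (leq_trans _ an).
  have := hm b (mkvar (Ordinal lt)); rewrite mbb' hm /x /= !eqxx.
  have [/val_inj//|_] := eqVneq (b : nat) b'.
  by lia.
by rewrite hm /x /= (negPf ij) -[_ == 0%N]/(c == ord0) (negPf c0) muln0.
Qed.

(** A tensor index [j] picks a variable in each slot; its monomial counts how often each variable is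
    picked. *)
Lemma SVpoint_monom (K : fieldType) (d : nat -> nat) (j : SVidx k n d) :
  exists m : monom d, forall u : forall i : 'I_k, 'I_(n i).+1 -> K,
    SVpoint u j = \prod_v u (tag v) (tagged v) ^+ expo m v.
Proof.
pose x (v : var) := #|[pred l | j (tag v) l == tagged v]|.
have [|m hm] := @expo_surj d x.
  move=> i; rewrite -[RHS]card_ord -sum1_card.
  rewrite (partition_big (fun l => j i l) xpredT) //=.
  by apply: eq_bigr => c _; rewrite /x /= sum1_card.
exists m => u; rewrite /SVpoint.
rewrite -(sig_big_dep xpredT (fun i => xpredT)
   (fun i c => u i c ^+ expo m (@mkvar i c))) /=.
apply: eq_bigr => i _; rewrite (partition_big (fun l => j i l) xpredT) //=.
apply: eq_bigr => c _; rewrite hm /x /= -prodr_const.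
by apply: eq_bigr => l /eqP ->.
Qed.

End Monomials.

(** * Flattenings of a sum of [s] decomposable tensors *)

Section Flattening.
Variables (K : fieldType) (k : nat) (n : nat -> nat) (s : nat).
Hypothesis charK0 : [pchar K] =i pred0.

(* Coefficients [(t, None)] and coordinates [(t, Some v)] of [s] points. *)
Definition param : finType := ('I_s * option (var k n))%type.

Definition meval_at (x : pt K param) (t : 'I_s) (w : var k n -> nat) : K :=
  \prod_v x (t, Some v) ^+ w v.

(** Here [w] is a bare exponent vector, so that the sum of two exponent vectors, a product of
    monomials, can be plugged in. *)
Definition tensor_coef (w : var k n -> nat) (x : pt K param) : K :=
  \sum_t x (t, None) * meval_at x t w.

Lemma meval_atD x t w w' :
  meval_at x t (fun v => w v + w' v)%N = meval_at x t w * meval_at x t w'.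
Proof. by rewrite -big_split; apply: eq_bigr => v _; rewrite exprD. Qed.

Lemma eq_tensor_coef w w' x : w =1 w' -> tensor_coef w x = tensor_coef w' x.
Proof.
move=> ww; apply: eq_bigr => t _; congr (_ * _).
by apply: eq_bigr => v _; rewrite ww.
Qed.

Lemma polyfun_tensor_coef w : polyfun (@pt_coord K param) (tensor_coef w).
Proof.
apply: polyfun_sum => t _; apply: polyfunM.
  exact: (polyfun_var (@pt_coord K param)).
apply: polyfun_prod => v _; apply: polyfunX; exact: (polyfun_var (@pt_coord K param)).
Qed.

(** The parameters are the coefficients [lam] and the vectors [u] of the [s] points. Quantifying
    over [m] leaves open which monomial is attached to [j]. *)
Lemma secant_cone_param (d : nat -> nat) (z : pt K (SVidx k n d)) :
  secant_cone s z -> zclosure (fun z : pt K (SVidx k n d) => exists x : pt K param,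
    forall j (m : monom k n d), (forall u : forall i : 'I_k, 'I_(n i).+1 -> K,
      SVpoint u j = \prod_v u (tag v) (tagged v) ^+ expo m v) ->
    z j = tensor_coef (expo m) x) z.
Proof.
move=> zs p hp; apply: zs => w [q [lam [qX _ wE]]]; apply: hp.
have [u hu] := fin_all_exists qX.
exists (fun c => if c.2 is Some v then u c.1 (tag v) (tagged v) else lam c.1).
move=> j m hm; rewrite wE; apply: eq_bigr => t _; congr (_ * _).
by rewrite hu hm.
Qed.

Section Minor.
Variables (e0 e1 : nat -> nat).
Variables (r : 'I_s -> monom k n e0) (c : 'I_s -> monom k n e1).

Definition flat (m : monom k n e0) (m' : monom k n e1) : pt K param -> K :=
  tensor_coef (fun v => expo m v + expo m' v)%N.

Definition flat_minor (x : pt K param) : 'M[K]_s :=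
  \matrix_(i, j) flat (r i) (c j) x.

Lemma flatE m m' x :
  flat m m' x = \sum_t x (t, None) * meval_at x t (expo m) * meval_at x t (expo m').
Proof. by apply: eq_bigr => t _; rewrite meval_atD mulrA. Qed.

(* At the points [u_t = (p_v ^ t)_v], for distinct primes [p_v], the minor is a
   product of two Vandermonde matrices. *)
Lemma flat_minor_neq0 : injective r -> injective c ->
  exists x, \det (flat_minor x) != 0.
Proof.
move=> r_inj c_inj.
have [p p_inj p_prime] := injective_primes (var k n).
pose node w : nat := (\prod_v p v ^ w v)%N.
have node_inj w w' : node w = node w' -> w =1 w'.
  have nodeK u v : logn (p v) (node u) = u v.
    rewrite logn_prod => [|v']; last by rewrite expn_gt0 prime_gt0.
    rewrite (bigD1 v) //= lognX logn_prime // eqxx muln1 big1 ?addn0 // => v' vv'.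
    by rewrite lognX logn_prime // (inj_eq p_inj) eq_sym (negPf vv') muln0.
  by move=> ww v; rewrite -(nodeK w) ww nodeK.
pose x (i : param) : K := if i.2 is Some v then (p v)%:R ^+ i.1 else 1.
have xE t w : meval_at x t w = (node w)%:R ^+ t.
  rewrite natr_prod -prodrXl; apply: eq_bigr => v _.
  by rewrite /x /= natrX -!exprM mulnC.
pose V e (g : 'I_s -> monom k n e) : 'M[K]_s :=
  Vandermonde s (\row_i (node (expo (g i)))%:R).
have V0 e (g : 'I_s -> monom k n e) : injective g -> \det (V e g) != 0.
  move=> g_inj; apply: det_Vandermonde_neq0 => i j; rewrite !mxE.
  by move/(natr_inj_pchar0 charK0)/node_inj/expo_inj/g_inj.
exists x; have -> : flat_minor x = (V _ r)^T *m V _ c.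
  apply/matrixP => i j; rewrite !mxE flatE; apply: eq_bigr => t _.
  by rewrite !mxE !xE mul1r.
by rewrite det_mulmx det_tr mulf_neq0 ?V0.
Qed.

(* The flattening has rank at most [s], so an entry outside an invertible
   [s * s] minor is determined by the row and the column it lies in. *)
Lemma flat_entry x m m' :
  \det (flat_minor x) ^+ 2 * flat m m' x =
  \det (flat_minor x) *
    \sum_i \sum_j flat m (c i) x * (\adj (flat_minor x)) i j * flat (r j) m' x.
Proof.
(* The extra factor [\det A] on both sides makes the singular case trivial. *)
set A := flat_minor x; have [->|A0] := eqVneq (\det A) 0.
  by rewrite expr2 !mul0r.
pose S := \matrix_(i, t) (x (t, None) * meval_at x t (expo (r i))).
pose T := \matrix_(t, j) meval_at x t (expo (c j)).
pose a := \row_t (x (t, None) * meval_at x t (expo m)).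
pose b := \col_t meval_at x t (expo m').
have AE : A = S *m T.
  apply/matrixP => i j; rewrite !mxE flatE; apply: eq_bigr => t _.
  by rewrite !mxE.
have : \det A != 0 by [].
rewrite {1}AE det_mulmx mulf_eq0 negb_or -!unitfE -!unitmxE => /andP[Su Tu].
(* Multiplied by [S] on the left, this reads [A *m \adj A *m S = \det A *: S]. *)
have adjA : T *m \adj A *m S = (\det A)%:M.
  apply: (can_inj (mulKmx Su)).
  by rewrite !mulmxA -AE mul_mx_adj scalar_mxC.
have -> : flat m m' x = (a *m b) 0 0.
  by rewrite mxE flatE; apply: eq_bigr => t _; rewrite !mxE.
transitivity (\det A * (a *m (T *m \adj A *m S) *m b) 0 0).
  by rewrite adjA mul_mx_scalar -scalemxAl [in RHS]mxE mulrA expr2.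
congr (_ * _).
have -> : a *m (T *m \adj A *m S) *m b = (a *m T) *m \adj A *m (S *m b).
  by rewrite !mulmxA.
rewrite mxE exchange_big /=; apply: eq_bigr => j _.
rewrite mxE mulr_suml; apply: eq_bigr => i _.
congr (_ * _ * _); rewrite !mxE flatE; apply: eq_bigr => t _; rewrite !mxE //.
Qed.

End Minor.

(** [R0] and [R1] are the rows and columns off the minor. Unique factorization makes the products
    from [R0] and [R1] pairwise distinct and absent from all other entries, so exactly these
    coordinates are eliminated. *)
Lemma zdim_le_secant (e0 e1 d : nat -> nat)
    (R0 : {set monom k n e0}) (R1 : {set monom k n e1}) :
  (forall i : 'I_k, e0 i + e1 i = d i)%N ->
  #|~: R0| = s -> #|~: R1| = s ->
  (forall m r m' r', m \in R0 -> r \in R1 ->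
     (forall v, expo m v + expo r v = expo m' v + expo r' v)%N ->
     m = m' /\ r = r') ->
  zdim_le (@secant_cone K k n d s) ((Nnd k n d)%:Z - (#|R0| * #|R1|)%N%:Z).
Proof.
move=> ed sR0 sR1 uniqR.
have [mul hmul] := monom_mul n ed.
pose D := [set mul p | p in setX R0 R1].
have cardD : #|D| = (#|R0| * #|R1|)%N.
  rewrite card_in_imset ?cardsX // => -[m r] [m' r']; rewrite !inE /=.
  move=> /andP[mR rR] _ eqm.
  by have [|-> ->] := uniqR m r m' r' mR rR => // v; rewrite -!(hmul (_, _)) eqm.
pose B : finType := {b : monom k n d | b \notin D}.
have cardB : #|B|%:Z = (Nnd k n d)%:Z - (#|R0| * #|R1|)%N%:Z.
  rewrite card_sig -card_monom -(cardsC D) cardD PoszD [RHS]addrC addKr; congr Posz.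
  by apply: eq_card => b; rewrite !inE.
rewrite -cardB.
have enumR (T : finType) (R : {set T}) : #|~: R| = s ->
    exists2 g : 'I_s -> T, injective g & forall i, g i \notin R.
  move=> sR; exists (fun i => enum_val (cast_ord (esym sR) i)).
    by move=> i j /enum_val_inj /cast_ord_inj.
  by move=> i; have := enum_valP (cast_ord (esym sR) i); rewrite inE.
have [g0 g0_inj g0R] := enumR _ _ sR0.
have [g1 g1_inj g1R] := enumR _ _ sR1.
have [phi hphi] := fin_all_exists (@SVpoint_monom k n K d).
have [x0 Dx0] := flat_minor_neq0 g0_inj g1_inj.
pose y (b : B) := tensor_coef (expo (val b)).
have flat_mul m r x : flat m r x = tensor_coef (expo (mul (m, r))) x.
  by apply: eq_tensor_coef => v; rewrite hmul.
have py_flat m r : ~~ ((m \in R0) && (r \in R1)) -> polyfun y (flat m r).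
  move=> mr; have nD : mul (m, r) \notin D.
    apply: contra mr => /imsetP[[m' r']]; rewrite inE /= => /andP[mR rR] eqm.
    have [|<- <-] := uniqR m' r' m r mR rR; last by rewrite mR.
    by move=> v; rewrite -!(hmul (_, _)) eqm.
  pose b : B := exist (fun b => is_true (b \notin D)) _ nD.
  by apply: eq_polyfun (polyfun_var y b) => x; rewrite flat_mul.
pose A := flat_minor g0 g1.
have pyA i j : polyfun y (fun x => A x i j).
  apply: eq_polyfun (py_flat (g0 i) (g1 j) _) => [x|]; first by rewrite mxE.
  by rewrite (negPf (g0R i)).
have pydet : polyfun y (fun x => \det (A x)) by apply: polyfun_det.
apply: (@zdim_le_param K param charK0 _ B (fun j => tensor_coef (expo (phi j))) y
  (fun x => \det (A x) ^+ 2) x0).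
- by move=> j; apply: polyfun_tensor_coef.
- apply: polyfunX; apply: polyfun_det => i j.
  apply: eq_polyfun (polyfun_tensor_coef (fun v => expo (g0 i) v + expo (g1 j) v)%N).
  by move=> x; rewrite mxE.
- by rewrite expf_neq0.
- exact: polyfunX.
- move=> j; case: (boolP (phi j \in D)) => [/imsetP[[m r] mrD ->]|nD].
    (* Every entry in the formula of [flat_entry] lies in a row [g0] or a column [g1], hence outside
       the block of [R0] and [R1], and is polynomial in [y]. *)
    apply: (@eq_polyfun _ _ _ _ (fun x => \det (A x) *
      \sum_i \sum_l flat m (g1 i) x * (\adj (A x)) i l * flat (g0 l) r x)) => [x|].
      by rewrite -flat_mul flat_entry.
    apply: polyfunM => //; apply: polyfun_sum => i _; apply: polyfun_sum => l _.
    apply: polyfunM; last by apply: py_flat; rewrite (negPf (g0R l)).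
    apply: polyfunM; first by apply: py_flat; rewrite (negPf (g1R i)) andbF.
    exact: polyfun_adj.
  apply: polyfunM; first exact: polyfunX.
  exact: (polyfun_var y (exist (fun b => is_true (b \notin D)) _ nD)).
move=> z /secant_cone_param zc p hp; apply: zc => w [x hx]; apply: hp.
by exists x => j; apply: hx.
Qed.

End Flattening.

(** * Choice of the monomials and the final count *)

Lemma lam0P (k : nat) (e : nat -> nat) : (2 <= k)%N ->
  (exists2 j, (j <= k - 2)%N & e j != 0%N) ->
  (lam0 k e < k.-1)%N /\ (0 < e (lam0 k e))%N.
Proof.
move=> k2 [j jk ej].
have hasj : has (fun j => e j != 0%N) (iota 0 k).
  by apply/hasP; exists j => //; rewrite mem_iota /=; lia.
have lk : (lam0 k e < k)%N by move: hasj; rewrite has_find size_iota.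
have := nth_find 0%N hasj; rewrite -/(lam0 k e) nth_iota // add0n -lt0n => el.
split=> //; suff : (lam0 k e <= j)%N by lia.
rewrite leqNgt; apply/negP => /(before_find 0%N).
by rewrite nth_iota ?add0n ?ej //; lia.
Qed.

Theorem mainTheorem2 (K : closedFieldType) (charK0 : [pchar K] =i pred0)
  (k : nat) (n d e0 : nat -> nat) (s : nat)
  (hk : (2 <= k)%N)
  (hn : forall i, (i < k)%N -> (0 < n i)%N)
  (hd1 : forall i, (i < k.-1)%N -> d i = 1%N)
  (hd2 : (2 <= d k.-1)%N)
  (he0 : forall j, (j < k)%N -> (e0 j <= d j)%N)
  (he0last : (1 <= e0 k.-1 <= (d k.-1).-1)%N)
  (hL0 : exists2 j, (j <= k - 2)%N & e0 j != 0%N)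
  (hL1 : exists2 j, (j <= k - 2)%N & (d j - e0 j)%N != 0%N)
  (hs : (0 < s)%N)
  (C0 : forall e, e = e0 \/ e = (fun j => d j - e0 j)%N ->
          (Nnd k n e)%:Z - (sumLam k n e)%:Z + 1 <= s%:Z)
  (C1 : forall e, e = e0 \/ e = (fun j => d j - e0 j)%N ->
          (n (lam0 k e))%:Z >= (Nnd k n e)%:Z - s%:Z /\
          (Nnd k n e)%:Z - s%:Z > 0) :
  let e1 := (fun j => d j - e0 j)%N in
  let N0 := (Nnd k n e0)%:Z in
  let N1 := (Nnd k n e1)%:Z in
  let D := (Dn k n)%:Z in
  let E := D - ((N0 - s%:Z) + (N1 - s%:Z)) in
  let F := s%:Z * (D - E) + (Nnd k n d)%:Z - 1
           - (N1 * (N0 - s%:Z) + N0 * (N1 - s%:Z))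
           + (N0 - s%:Z) * (N1 - s%:Z) in
  secant_dim_le K k n d s F.
Proof.
move=> e1 N0 N1 D E F.
have lt_k i : (i < k.-1)%N -> (i < k)%N by lia.
have [j0k e0j] := lam0P hk hL0; have [j1k e1j] := lam0P hk hL1.
have [ub0 pos0] := C1 e0 (or_introl erefl).
have [ub1 pos1] := C1 e1 (or_intror erefl).
have le0 : (Nnd k n e0 - s <= n (lam0 k e0))%N by lia.
have le1 : (Nnd k n e1 - s <= n (lam0 k e1))%N by lia.
have [R0 cR0 R0P] := @monom_family k n e0 (Ordinal (lt_k _ j0k)) _ e0j le0.
have [R1 cR1 R1P] := @monom_family k n e1 (Ordinal (lt_k _ j1k)) _ e1j le1.
(* Positivity in [C1] makes the truncated difference [Nnd k n e0 - s] exact. *)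
have sR0 : #|~: R0| = s by have := cardsC R0; rewrite cR0 card_monom; lia.
have sR1 : #|~: R1| = s by have := cardsC R1; rewrite cR1 card_monom; lia.
have ed (i : 'I_k) : (e0 i + e1 i = d i)%N by rewrite subnKC ?he0.
have uniqR m r m' r' : m \in R0 -> r \in R1 ->
    (forall v, expo m v + expo r v = expo m' v + expo r' v)%N ->
    m = m' /\ r = r'.
  move=> mR rR; apply: monom_factor_unique => i.
  (* Below [k.-1] the degree [d i] is 1, so [e0 i] or [e1 i] is 0. *)
  have [ik|ki] := ltnP i k.-1.
    have := ed i; rewrite hd1 //.
    by case: (e0 i) => [|[|?]] // ?; [constructor 1 | constructor 2; lia].
  (* Both indices [lam0] are below [k.-1], so in the last factor the chosen monomials involve only
     variable [0]. *)
  constructor 3 => c c0; rewrite R0P ?R1P // -val_eqE /=; lia.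
rewrite /secant_dim_le.
(* [D - E] is [#|R0| + #|R1|], and after substituting for [N0] and [N1] all terms in [s] cancel; the
   [+ 1] comes from the affine cone. *)
have -> : F + 1 = (Nnd k n d)%:Z - (#|R0| * #|R1|)%N%:Z.
  have eN0 : N0 = s%:Z + #|R0|%:Z by rewrite cR0; lia.
  have eN1 : N1 = s%:Z + #|R1|%:Z by rewrite cR1; lia.
  by rewrite /F /E eN0 eN1 PoszM; ring.
exact: zdim_le_secant.
Qed.
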